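(* Suppose that, for $j=1,\ldots,q$, $(N_j,\rho_j)$ is a proper geodesic metric space such that all its horofunctions are Busemann points, and $\delta(h_j,h_j')=\infty$ for all Busemann points $h_j\neq h_j'$ of $(N_j,\rho_j)$. Then every horofunction $h$ of $(\prod_{j=1}^q N_j,d_\infty)$ is a Busemann point, and $(\mathcal{P}(h),\delta)$ is isometric to $(\mathbb{R}^J/\mathrm{Sp}(\mathbf{1}),\|\cdot\|_{\mathrm{var}})$ for some non-empty $J\subseteq\{1,\ldots,q\}$.
   Context: A metric space is proper if all closed balls are compact, and geodesic if any two points $x,y$ are joined by a path $\gamma\colon[a,b]\to M$ with $\gamma(a)=x$, $\gamma(b)=y$ and $d(\gamma(s),\gamma(t))=|s-t|$ for all $s,t$. The product $\prod_{j=1}^q N_j$ carries the sup-metric $d_\infty(x,y)=\max_j\rho_j(x_j,y_j)$; it is a proper geodesic metric space when each factor is. Let $(M,d)$ be a metric space with fixed basepoint $b\in M$. For $y\in M$ put $h_y(z)=d(z,y)-d(b,y)$. The metric compactification $\overline{M}^h$ is the closure of $\{h_y\colon y\in M\}$ in $\mathbb{R}^M$ with the topology of pointwise convergence. The elements of $\partial\overline{M}^h=\overline{M}^h\setminus\{h_y\colon y\in M\}$ are called horofunctions. A sequence $(y^n)_{n\geq 0}$ in $M$ is an almost geodesic sequence if $d(y^n,y^0)\to\infty$ and for each $\varepsilon>0$ there exists $N\geq 0$ such that $d(y^m,y^k)+d(y^k,y^0)-d(y^m,y^0)<\varepsilon$ for all $m\geq k\geq N$. In a proper geodesic metric space, a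 horofunction $h$ is a Busemann point if there is an almost geodesic sequence $(y^n)$ with $h(x)=\lim_{n} d(x,y^n)-d(b,y^n)$ for all $x\in M$. For Busemann points $h_1,h_2$ the detour cost is $H(h_1,h_2)=\inf_{(z^n)}\liminf_n \big(d(b,z^n)+h_2(z^n)\big)\in[0,\infty]$, where the infimum is over all sequences $(z^n)$ in $M$ with $h_{z^n}\to h_1$ pointwise. The detour distance is $\delta(h_1,h_2)=H(h_1,h_2)+H(h_2,h_1)$; it is independent of the basepoint. On the set of Busemann points, $\delta$ satisfies the axioms of a metric except that it may take the value $\infty$. The part $\mathcal{P}(h)$ of a Busemann point $h$ is the set of Busemann points $h'$ with $\delta(h,h')<\infty$; it is a metric space under $\delta$. For a finite non-empty set $J$, $\mathrm{Sp}(\mathbf{1})=\{\lambda(1,\ldots,1)\colon\lambda\in\mathbb{R}\}\subset\mathbb{R}^J$, and the variation norm on $\mathbb{R}^J/\mathrm{Sp}(\mathbf{1})$ is $\|\overline{x}\|_{\mathrm{var}}=\max_{j\in J}x_j+\max_{j\in J}(-x_j)$. *)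

(* Defs.v *)
From HB Require Import structures.
From mathcomp Require Import all_boot all_order all_algebra.
From mathcomp Require Import all_classical all_reals all_analysis.
From mathcomp Require Import generic_quotient ring_quotient lra.

Set Implicit Arguments.
Unset Strict Implicit.
Unset Printing Implicit Defensive.

Import Order.TTheory GRing.Theory Num.Theory.
Import numFieldNormedType.Exports.
Import Quotient.

Local Open Scope classical_set_scope.
Local Open Scope ring_scope.
Local Open Scope quotient_scope.

Section MetricSpaces.
Context {R : realType}.

(* The library's [closed_ball] is the closure of the open ball, which in a
   general metric space may be smaller than the closed ball used here. *)
Definition proper_space (M : metricType R) : Prop :=
  forall (x : M) (r : R), compact [set y : M | mdist x y <= r].

(* Only the values of [gamma] on [a, b] matter. *)
Definition geodesic_space (M : metricType R) : Prop :=
  forall x y : M, exists (a b : R) (gamma : R -> M),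
    [/\ a <= b, gamma a = x, gamma b = y &
      forall s t : R, s \in `[a, b] -> t \in `[a, b] ->
        mdist (gamma s) (gamma t) = `|s - t|].

End MetricSpaces.

Section SupProduct.
Context {R : realType} {q : nat}.

Definition sup_prod (N : 'I_q -> metricType R) : Type := forall j, N j.

Variable N : 'I_q -> metricType R.

HB.instance Definition _ := Choice.copy (sup_prod N) (forall j, N j).

(* Distances are nonnegative, so the initial value 0 does not affect the
   maximum. *)
Definition sup_dist (x y : sup_prod N) : R :=
  \big[Num.max/0]_(j < q) mdist (x j) (y j).

Let sup_distxx x : sup_dist x x = 0.
Proof. by rewrite /sup_dist; elim/big_ind: _ => // [u v -> ->|j _]; rewrite ?maxxx ?mdistxx. Qed.

Let sup_dist_positivity x y : sup_dist x y = 0 -> x = y.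
Proof.
move=> xy0; apply: functional_extensionality_dep => j.
apply: mdist_positivity; apply/eqP; rewrite eq_le mdist_ge0 andbT -xy0.
exact: (le_bigmax _ (fun j => mdist (x j) (y j))).
Qed.

Let sup_dist_sym x y : sup_dist x y = sup_dist y x.
Proof. by apply: eq_bigr => j _; rewrite metric_sym. Qed.

Let sup_dist_triangle y x z : sup_dist x z <= sup_dist x y + sup_dist y z.
Proof.
apply: bigmax_le => [|j _]; first by rewrite addr_ge0 ?bigmax_ge_id.
apply: (le_trans (metric_triangle _ (y j) _)); apply: lerD.
  exact: (le_bigmax _ (fun j => mdist (x j) (y j))).
exact: (le_bigmax _ (fun j => mdist (y j) (z j))).
Qed.

HB.instance Definition _ := isMetric.Build R (sup_prod N)
  sup_distxx sup_dist_positivity sup_dist_sym sup_dist_triangle.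

End SupProduct.

Section MetricCompactification.
Context {R : realType} {M : metricType R}.
Implicit Types (b : M) (h : {ptws M -> R}).

Definition internal_functional b (y : M) : {ptws M -> R} :=
  fun z => mdist z y - mdist b y.

Definition metric_compactification b : set {ptws M -> R} :=
  closure (range (internal_functional b)).

Definition horofunction b : set {ptws M -> R} :=
  metric_compactification b `\` range (internal_functional b).

Definition almost_geodesic (y : nat -> M) : Prop :=
  mdist (y n) (y 0%N) @[n --> \oo] --> +oo /\
  forall e : R, 0 < e -> exists N0 : nat, forall m k : nat,
    (N0 <= k)%N -> (k <= m)%N ->
    mdist (y m) (y k) + mdist (y k) (y 0%N) - mdist (y m) (y 0%N) < e.

Definition busemann b : set {ptws M -> R} :=
  [set h | horofunction b h /\
    exists y : nat -> M, almost_geodesic y /\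
      forall x : M, mdist x (y n) - mdist b (y n) @[n --> \oo] --> h x].

Local Open Scope ereal_scope.

Definition detour_cost b h1 h2 : \bar R :=
  ereal_inf [set limn_einf (fun n => (mdist b (z n) + h2 (z n))%:E) |
    z in [set z : nat -> M |
      forall x : M, internal_functional b (z n) x @[n --> \oo] --> h1 x]].

Definition detour_distance b h1 h2 : \bar R :=
  detour_cost b h1 h2 + detour_cost b h2 h1.

Definition part b h : set {ptws M -> R} :=
  [set h' | busemann b h' /\ detour_distance b h h' < +oo].

End MetricCompactification.

Section VariationNorm.
Context {R : realType} {I : finType}.

Definition Sp1 : {pred {ffun I -> R}} :=
  fun x => `[< exists l : R, x = [ffun=> l] >].

Let Sp1_zmod_closed : zmod_closed Sp1.
Proof.
split; first by apply/asboolP; exists 0; apply/ffunP => i; rewrite !ffunE.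
move=> x y /asboolP[l ->] /asboolP[m ->]; apply/asboolP; exists (l - m).
by apply/ffunP => i; rewrite !ffunE.
Qed.

HB.instance Definition _ :=
  GRing.isZmodClosed.Build {ffun I -> R} Sp1 Sp1_zmod_closed.

(* The initial value is one of the coordinates, so this is the maximum of the
   coordinates whenever [I] is nonempty. *)
Definition max_coord (x : {ffun I -> R}) : R :=
  \big[Num.max/head 0 (codom x)]_i x i.

Definition var_norm (v : {quot Sp1}) : R :=
  max_coord (repr v) + max_coord (- repr v).

Lemma max_coord_ge (x : {ffun I -> R}) i : x i <= max_coord x.
Proof. exact: le_bigmax. Qed.

Lemma max_coord_attained (x : {ffun I -> R}) :
  I -> exists i, max_coord x = x i.
Proof.
move=> i0; rewrite /max_coord; elim/big_ind: _ => [|u v [i ->] [j ->]|i _].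
- have: head 0 (codom x) \in codom x.
    have: x i0 \in codom x by exact: codom_f.
    by case: (codom x) => //= a s _; rewrite mem_head.
  by move=> /codomP[i ->]; exists i.
- by case: leP => _; [exists j | exists i].
- by exists i.
Qed.

Lemma var_norm_pi (x : {ffun I -> R}) : I ->
  var_norm (\pi_{quot Sp1} x) = max_coord x + max_coord (- x).
Proof.
move=> i0.
have shift (y : {ffun I -> R}) (l : R) :
    max_coord (y + [ffun=> l]) = max_coord y + l.
  apply/eqP; rewrite eq_le; apply/andP; split.
    have [i ->] := max_coord_attained (y + [ffun=> l]) i0.
    by rewrite !ffunE lerD2r max_coord_ge.
  have [i ->] := max_coord_attained y i0.
  by have := max_coord_ge (y + [ffun=> l]) i; rewrite !ffunE.
have /eqP : \pi_{quot Sp1} (repr (\pi_{quot Sp1} x)) = \pi_{quot Sp1} x.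
  exact: reprK.
rewrite /var_norm -idealrBE => /asboolP[l /eqP].
rewrite subr_eq => /eqP ->; rewrite opprD.
have -> : - [ffun=> l] = [ffun=> - l] :> {ffun I -> R}.
  by apply/ffunP => i; rewrite !ffunE.
rewrite [[ffun=> l] + _]addrC [in X in _ + X]addrC.
by rewrite !shift; lra.
Qed.

End VariationNorm.

Arguments Sp1 R I : clear implicits.

(* [(P(h), delta)] is isometric to [R^J / Sp(1)]; the equation in [\bar R]
   includes that the detour distance is finite on the part. *)
Definition part_isometric_var {R : realType} {M : metricType R} (b : M)
    (h : {ptws M -> R}) {q : nat} (J : {set 'I_q}) : Prop :=
  exists F : {ptws M -> R} -> {quot (Sp1 R {j : 'I_q | j \in J})},
    set_bij (part b h) setT F /\
    forall h1 h2, part b h h1 -> part b h h2 ->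
      detour_distance b h1 h2 = (var_norm (F h1 - F h2))%:E.

(* Main.v *)
(* Along an ultrafilter converging to a horofunction [h] of the product, set
   [g_j] to be the limit of [rho_j(., y_j) - rho_j(b_j, y_j)] and [a_j] the limit of
   [rho_j(b_j, y_j) - d(b, y)].  If [J] collects the [j] with [a_j > -oo], then
   [h x = max_(j in J) (g_j (x_j) + a_j)] and every such [g_j] is a horofunction,
   hence a Busemann point, of its factor.  Running along the rays of the [g_j]
   simultaneously shows that any such maximum is a Busemann point.  For Busemann
   points [H(h, h') = sup (h' - h)], so a finite detour distance means a bounded
   difference; pushing all coordinates but one towards infinity compares the
   [g_j] and [a_j] one at a time, so within a part only the [a_j] vary, and
   [H(h, h') = max_j (a'_j - a_j)]. *)

Require Import Defs.
From mathcomp Require Import all_boot all_order all_algebra.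
From mathcomp Require Import all_classical all_reals all_analysis.
From mathcomp Require Import generic_quotient ring_quotient lra.

Set Implicit Arguments.
Unset Strict Implicit.
Unset Printing Implicit Defensive.

Import Order.TTheory GRing.Theory Num.Theory.
Import numFieldNormedType.Exports.
Import Quotient.

Local Open Scope classical_set_scope.
Local Open Scope ring_scope.
Local Open Scope quotient_scope.

(** * Busemann points and almost optimal rays *)

Section Ultrafilters.
Context {R : realType} {T : Type} {U : set_system T}.
Hypothesis UU : UltraFilter U.

Lemma ultra_fmap (V : Type) (f : T -> V) : UltraFilter (f @ U).
Proof.
split; first exact: fmap_proper_filter.
move=> G GG FG; rewrite eqEsubset; split=> // A GA.
have [//|UA] := in_ultra_setVsetC (f @^-1` A) UU.
have /(filterI GA) : G (~` A) by exact: FG.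
by rewrite setICr => /filter_not_empty.
Qed.

Lemma ultra_bounded_cvg (f : T -> R) (k : R) :
  (\forall i \near U, `|f i| <= k) -> exists l : R, f i @[i --> U] --> l.
Proof.
move=> fk; have fU := ultra_fmap f.
have := segment_compact (a := - k) (b := k); rewrite compact_ultra.
move=> /(_ _ fU) [|l [_ fl]]; last by exists l.
by near=> i; rewrite /= in_itv/= -ler_norml; near: i.
Unshelve. all: by end_near. Qed.

Lemma ultra_proper_cvg (M : metricType R) (f : T -> M) (x : M) (k : R) :
  proper_space M -> (\forall i \near U, mdist x (f i) <= k) ->
  exists p : M, forall e : R, 0 < e -> \forall i \near U, mdist p (f i) <= e.
Proof.
move=> Mp fk; have fU := ultra_fmap f.
have := Mp x k; rewrite compact_ultra => /(_ _ fU fk) [p [_ fp]].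
by exists p => e e0; exact: metricType_numDomainType.cvgr_dist_le.
Qed.

End Ultrafilters.

Section Metric.
Context {R : realType} {M : metricType R}.
Implicit Types (w x z b : M) (h : {ptws M -> R}).

(* [metric_sym] and [metric_triangle] at the canonical instance of [mdist] for
   a [realType], as [lra] compares atoms syntactically. *)
Lemma mdistC x z : mdist x z = mdist z x.
Proof. exact: metric_sym. Qed.

Lemma mdist_triangle x z w : mdist x w <= mdist x z + mdist z w.
Proof. exact: metric_triangle. Qed.

Lemma ler_mdist_sub x z w : mdist x w - mdist z w <= mdist x z.
Proof. by rewrite lerBlDr mdist_triangle. Qed.

Lemma geodesic_point x z (r : R) : geodesic_space M ->
  0 <= r <= mdist x z -> exists w, mdist x w = r /\ mdist w z = mdist x z - r.
Proof.
move=> /(_ x z)[a [c [g [ac ga gc gd]]]] /andP[r0].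
have aI : a \in `[a, c] by rewrite in_itv/= lexx.
have cI : c \in `[a, c] by rewrite in_itv/= lexx andbT.
have dxz : mdist x z = c - a by rewrite -ga -gc gd// ler0_norm ?opprB// subr_le0.
rewrite dxz => rc; exists (g (a + r)).
have rI : a + r \in `[a, c] by rewrite in_itv/=; apply/andP; split; lra.
rewrite -ga -gc !gd//; split; first by rewrite ler0_norm; lra.
by rewrite ler0_norm; lra.
Qed.

Lemma internal_functional_ge b x z : - mdist b x <= internal_functional b x z.
Proof. by rewrite /internal_functional lerBrDr addNr mdist_ge0. Qed.

(** Internal functionals are bounded below by [- mdist b y]. This is the criterion by which limits
    are recognised as horofunctions. *)
Lemma unbounded_not_internal b h : (forall k, exists w, h w <= - k) ->
  ~ range (internal_functional b) h.
Proof.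
move=> hN [y _ hE]; have [w] := hN (mdist b y + 1).
by have := internal_functional_ge b y w; rewrite hE; lra.
Qed.

Lemma cvg_metric_compactification (T : Type) (F : set_system T) b (y : T -> M) h :
  ProperFilter F ->
  (forall x, mdist x (y i) - mdist b (y i) @[i --> F] --> h x) ->
  metric_compactification b h.
Proof.
move=> FF hy; have : {ptws, internal_functional b (y i) @[i --> F] --> h}.
  by apply/pointwise_cvgP => x; exact: hy.
move=> yh B /yh FB; have [i Bi] := @filter_ex _ F _ _ FB.
by exists (internal_functional b (y i)); split => //; exists (y i).
Qed.

(* Moving from [b] a distance [k] towards [y i] lowers the limit by [k]; by
   properness these points accumulate. *)
Lemma escaping_limit_unbounded (T : Type) (U : set_system T) b (y : T -> M) h :
  UltraFilter U -> proper_space M -> geodesic_space M ->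
  (forall x, mdist x (y i) - mdist b (y i) @[i --> U] --> h x) ->
  mdist b (y i) @[i --> U] --> +oo ->
  forall k, exists w, h w <= - k.
Proof.
(* The bound is made nonnegative so that it can serve as a length along a geodesic. *)
move=> UU Mp Mg hy yoo k0; pose k := Num.max k0 0.
have kk0 : k0 <= k by rewrite /k le_max lexx.
have k_ge0 : 0 <= k by rewrite /k le_max lexx orbT.
have yk : \forall i \near U, k <= mdist b (y i) by move/cvgryPge : yoo.
have /choice[w wP] : forall i, exists w, k <= mdist b (y i) ->
    mdist b w = k /\ mdist w (y i) = mdist b (y i) - k.
  move=> i; have [ki|] := leP k (mdist b (y i)); last by exists b.
  by have [|w ?] := @geodesic_point b (y i) k Mg; [rewrite k_ge0|exists w].
have [|p pw] := @ultra_proper_cvg _ _ _ UU _ w b k Mp.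
  by near=> i; have [|-> //] := wP i; near: i.
exists p; apply: (@le_trans _ _ (- k)); last by rewrite lerN2.
apply/ler_addgt0Pr => e e0; apply: (cvgr_to_le (hy p)); near=> i.
have [|wi1 wi2] := wP i; first by near: i.
have : mdist p (w i) <= e by near: i; exact: pw.
have := mdist_triangle p (w i) (y i); lra.
Unshelve. all: by end_near. Qed.

(* A basepoint-free form of the Busemann property: [y] is almost optimal for [h],
   with [t n] in the role of the distance from the basepoint to [y n]. *)
Definition ray_limit h (y : nat -> M) (t : nat -> R) : Prop :=
  [/\ t n @[n --> \oo] --> +oo,
      forall x, mdist x (y n) - t n @[n --> \oo] --> h x &
      h (y n) + t n @[n --> \oo] --> 0].

Lemma limit_lipschitz (T : Type) (F : set_system T) {FF : ProperFilter F}
    (y : T -> M) (t : T -> R) h x z :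
  (forall x, mdist x (y i) - t i @[i --> F] --> h x) ->
  h x - h z <= mdist x z.
Proof.
move=> hy; apply: (cvgr_to_le (cvgB (hy x) (hy z))).
by near=> i; have := ler_mdist_sub x z (y i); rewrite !fctE; lra.
Unshelve. all: by end_near. Qed.

Lemma ray_limit_lipschitz h (y : nat -> M) (t : nat -> R) x z :
  ray_limit h y t -> h x - h z <= mdist x z.
Proof. by move=> [_ hy _]; exact: limit_lipschitz hy. Qed.

Lemma ray_limit_unbounded h (y : nat -> M) (t : nat -> R) : ray_limit h y t ->
  forall k, exists w, h w <= - k.
Proof.
move=> [too _ h0] k.
suff /filter_ex[n hn] : \forall n \near \oo, h (y n) <= - k by exists (y n).
have tk : \forall n \near \oo, k + 1 <= t n by move/cvgryPge : too.
have hk : \forall n \near \oo, h (y n) + t n <= 1.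
  by apply: (cvgr_le _ h0); exact: ltr01.
by apply: filterS2 tk hk => n; lra.
Qed.

(** Take [t n := mdist b (y n)]. The almost geodesic inequality is what yields
    [h (y n) + t n --> 0]. *)
Lemma busemann_ray b h : busemann b h ->
  h b = 0 /\ exists (y : nat -> M) (t : nat -> R), ray_limit h y t.
Proof.
move=> [_ [y [[yoo yg] hy]]]; have hb : h b = 0.
  have := hy b; under eq_cvg do rewrite subrr.
  by move=> /(cvg_unique _ (cvg_cst 0)) <-.
split=> //; exists y, (fun n => mdist b (y n)); split => //.
  apply/cvgryPge => k.
  have yk : \forall n \near \oo, k + mdist b (y 0%N) <= mdist (y n) (y 0%N).
    by move/cvgryPge : yoo.
  apply: filterS yk => n; have := mdist_triangle (y n) b (y 0%N).
  by rewrite (mdistC (y n) b); lra.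
apply/cvgrPdist_le => e e0; have [|N0 HN] := yg (e / 2); first lra.
have hy0 : \forall n \near \oo, h (y 0%N) - e / 2 <= mdist (y 0%N) (y n) - mdist b (y n).
  by apply: (cvgr_ge _ (hy (y 0%N))); lra.
near=> k; have kN : (N0 <= k)%N by near: k; exact: nbhs_infty_ge.
have ge0 : 0 <= mdist b (y k) + h (y k).
  suff : h b - h (y k) <= mdist b (y k) by rewrite hb; lra.
  exact: limit_lipschitz hy.
(* Upper bound: letting [m] tend to infinity in the almost geodesic inequality gives [h (y k) - h (y
   0) <= e / 2 - mdist (y k) (y 0)], and [mdist (y k) (y 0) - mdist b (y k)] is close to
   [h (y 0)]. *)
suff : h (y k) + (mdist (y k) (y 0%N) - h (y 0%N)) <= e / 2.
  have : h (y 0%N) - e / 2 <= mdist (y 0%N) (y k) - mdist b (y k) by near: k.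
  by rewrite (mdistC (y 0%N)) sub0r normrN ger0_norm; lra.
suff : h (y k) - h (y 0%N) <= e / 2 - mdist (y k) (y 0%N) by lra.
apply: (cvgr_to_le (cvgB (hy (y k)) (hy (y 0%N)))); near=> m; rewrite !fctE.
have km : (k <= m)%N by near: m; exact: nbhs_infty_ge.
have := HN m k kN km.
by rewrite (mdistC (y m) (y k)) (mdistC (y m) (y 0%N)); lra.
Unshelve. all: by end_near. Qed.

Lemma ray_limit_near h (y : nat -> M) (t : nat -> R) : ray_limit h y t ->
  forall (k : nat) (e : R), 0 < e -> exists N, forall n, (N <= n)%N ->
    forall i, (i <= k)%N -> mdist (y i) (y n) - t n <= h (y i) + e.
Proof.
move=> [_ hy _] k e e0.
have : \forall n \near \oo, forall i : 'I_k.+1, mdist (y i) (y n) - t n <= h (y i) + e.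
  by apply: filter_forall => i; apply: (cvgr_le _ (hy (y i))); lra.
move=> [N _ HN]; exists N => n Nn i; rewrite -ltnS => ik.
exact: (HN n Nn (Ordinal ik)).
Qed.

(* Along a sufficiently sparse subsequence, [mdist (y i) (y n) - t n] is
   uniformly close to [h (y i)] for all the [y i] selected before [y n]. *)
Lemma ray_limit_almost_geodesic h (y : nat -> M) (t : nat -> R) : ray_limit h y t ->
  exists phi : nat -> nat, (forall n, (n <= phi n)%N) /\ almost_geodesic (y \o phi).
Proof.
move=> ry; have := ry => -[too hy h0].
have /choice[N NP] : forall km : nat * nat, exists N, forall n, (N <= n)%N ->
    forall i, (i <= km.1)%N -> mdist (y i) (y n) - t n <= h (y i) + km.2.+1%:R^-1.
  by move=> [k m]; apply: (ray_limit_near ry) => /=.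
(* The first term makes the error at most [1 / (m + 1)] for all [y i] with [i <= phi m]; the second
   makes [phi] strictly increasing. As [phi 0 = 0], the initial point is kept. *)
pose fix phi n := if n is m.+1 then maxn (N (phi m, m)) (phi m).+1 else 0%N.
have phiS n : (phi n < phi n.+1)%N by rewrite /= leq_max leqnn orbT.
have phi_mono : {homo phi : k m / (k <= m)%N}.
  by apply: homo_leq => // [x|n]; [exact: leq_trans|exact: ltnW].
have phi_ge n : (n <= phi n)%N by elim: n => // n IH; exact: leq_ltn_trans (phiS n).
have phioo : phi n @[n --> \oo] --> \oo.
  by apply/cvgnyPge => k; near=> n; apply: leq_trans (phi_ge n);
  near: n; exact: nbhs_infty_ge.
have ty (z : M) (e : R) : 0 < e ->
    \forall n \near \oo, `|mdist z (y (phi n)) - t (phi n) - h z| <= e.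
  move=> e0; have /cvgrPdist_le/(_ _ e0) := cvg_comp _ _ phioo (hy z).
  by apply: filterS => n; rewrite distrC.
exists phi; split=> //; split=> /=.
  apply/cvgryPge => k.
  have tk : \forall n \near \oo, k - h (y (phi 0%N)) + 1 <= t (phi n).
    by have /cvgryPge := cvg_comp _ _ phioo too; apply.
  apply: filterS2 (ty (y (phi 0%N)) 1 ltr01) tk => n.
  by rewrite (mdistC (y (phi n))) ler_norml; lra.
move=> e e0.
have e80 : 0 < e / 8 by lra.
(* Four errors of at most [e / 8] will be added: the first at [k], the second at both [k] and
   [m.+1], the third at [m]. *)
have : \forall n \near \oo, [/\ h (y (phi n)) + t (phi n) <= e / 8,
    `|mdist (y 0%N) (y (phi n)) - t (phi n) - h (y 0%N)| <= e / 8 &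
    n.+1%:R^-1 <= e / 8].
  near=> n; split; near: n; last 2 first.
  - exact: ty.
  - have := near_infty_natSinv_lt (PosNum e80).
    by apply: filterS => n /= /ltW.
  have /cvgrPdist_le := cvg_comp _ _ phioo h0;
  move=> /(_ _ e80); apply: filterS => n /=; rewrite ler_norml; lra.
(* The threshold [N0.+1] excludes index 0, so the larger index has a predecessor [m]; when both
   indices agree the expression vanishes. *)
move=> [N0 _ NN0]; exists N0.+1 => -[|m] k Nk; first by case: k Nk.
rewrite leq_eqVlt => /predU1P[->|]; first by rewrite mdistxx; lra.
rewrite ltnS => km.
have [H1 H2 _] := NN0 k (ltnW Nk).
have [_ H3 _] := NN0 m.+1 (leq_trans (ltnW Nk) (leqW km)).
have [_ _ H4] := NN0 m (leq_trans (ltnW Nk) km).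
have H5 : mdist (y (phi k)) (y (phi m.+1)) - t (phi m.+1) <=
    h (y (phi k)) + m.+1%:R^-1.
  exact: NP (phi m, m) (phi m.+1) (leq_maxl _ _) (phi k) (phi_mono _ _ km).
move: H2 H3; rewrite !ler_norml !(mdistC _ (y 0%N)) => /andP[H2 H2'] /andP[H3 H3'].
by move: H4 H5; rewrite (mdistC (y (phi m.+1)) (y (phi k))); set u := _%:R^-1; lra.
Unshelve. all: by end_near. Qed.

(** Converse of [busemann_ray]: [h b = 0] allows [t n] to be replaced by [mdist b (y n)], and a
    sparse subsequence is almost geodesic. *)
Lemma ray_busemann b h (y : nat -> M) (t : nat -> R) :
  h b = 0 -> ray_limit h y t -> busemann b h.
Proof.
move=> hb ry; have := ry => -[too hy h0].
have hby x : mdist x (y n) - mdist b (y n) @[n --> \oo] --> h x.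
  rewrite -(subr0 (h x)) -hb; apply: cvg_trans (cvgB (hy x) (hy b)).
  by apply: near_eq_cvg; near=> n; rewrite !fctE; lra.
split.
  split; first exact: cvg_metric_compactification hby.
  by apply: unbounded_not_internal; exact: ray_limit_unbounded ry.
have [phi [phi_ge yg]] := ray_limit_almost_geodesic ry.
exists (y \o phi); split => // x; apply: (cvg_comp _ _ _ (hby x)) => //.
by apply/cvgnyPge => k; near=> n; apply: leq_trans (phi_ge n);
  near: n; exact: nbhs_infty_ge.
Unshelve. all: by end_near. Qed.

End Metric.

(** * Detour cost *)

Lemma le_limn_einf (R : realType) (u v : (\bar R)^nat) :
  (\forall n \near \oo, (u n <= v n)%E) -> (limn_einf u <= limn_einf v)%E.
Proof.
move=> uv; have einfE w : limn_einf w = ereal_sup [set ereal_inf (w @` V) | V in \oo].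
  by rewrite -limf_einfE.
rewrite !einfE; apply: ge_ereal_sup => _ [V Voo <-].
apply: le_ereal_sup_tmp; exists (ereal_inf (v @` (V `&` [set n | (u n <= v n)%E]))).
  by exists (V `&` [set n | (u n <= v n)%E]) => //; exact: filterI.
apply: le_ereal_inf_tmp => _ [n [Vn uvn] <-]; apply: le_trans uvn.
by apply: ereal_inf_lbound; exists n.
Qed.

Section Detour.
Context {R : realType} {M : metricType R}.
Implicit Types (x z b : M) (h : {ptws M -> R}).

(* This bound and the next one amount to [detour_cost b h h' = sup_x (h' x - h x)]
   for a Busemann point [h]. *)
Lemma detour_cost_ge b h h' x : (forall z, h' x - h' z <= mdist x z) ->
  ((h' x - h x)%:E <= detour_cost b h h')%E.
Proof.
move=> lip; apply: le_ereal_inf_tmp => _ [z /(_ x) zh <-].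
(* The Lipschitz bound puts [mdist b (z n) + h' (z n)] above this sequence, whose limit is the same
   for every competing [z]. *)
have : (h' x - internal_functional b (z n) x)%:E @[n --> \oo] --> (h' x - h x)%:E.
  by apply: cvg_EFin; [exact: nearW|exact: cvgB (cvg_cst _) zh].
move=> /cvg_limn_einf_sup[<- _]; apply: le_limn_einf; apply: nearW => n.
by rewrite lee_fin /internal_functional; have := lip (z n); lra.
Qed.

Lemma detour_cost_le b h h' (y : nat -> M) (t : nat -> R) (c : R) :
  ray_limit h y t -> h b = 0 -> (forall x, h' x - h x <= c) ->
  (detour_cost b h h' <= c%:E)%E.
Proof.
move=> [too hy h0] hb hc.
(* The ray itself is the competing sequence; [mdist b (y n) - t n] tends to [h b = 0]. *)
have by0 : mdist b (y n) + h (y n) @[n --> \oo] --> 0.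
  rewrite -[X in _ --> X](_ : h b + 0 = 0); last by rewrite hb addr0.
  apply: cvg_trans (cvgD (hy b) h0); apply: near_eq_cvg; apply: nearW => n.
  by rewrite !fctE; lra.
have bc : (c + (mdist b (y n) + h (y n)))%:E @[n --> \oo] --> c%:E.
  rewrite -[X in _ --> X%:E]addr0.
  by apply: cvg_EFin; [exact: nearW|exact: cvgD (cvg_cst _) by0].
apply: (@le_trans _ _ (limn_einf (fun n => (mdist b (y n) + h' (y n))%:E))).
  apply: ereal_inf_lbound; exists y => //= x.
  rewrite -(subr0 (h x)) -hb; apply: cvg_trans (cvgB (hy x) (hy b)).
  apply: near_eq_cvg; apply: nearW => n.
  by rewrite !fctE /internal_functional; lra.
have [<- _] := cvg_limn_einf_sup bc; apply: le_limn_einf; apply: nearW => n.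
by rewrite lee_fin; have := hc (y n); lra.
Qed.

Lemma detour_distance_lty_bounded b h h' : h b = 0 -> h' b = 0 ->
  (forall x z, h x - h z <= mdist x z) -> (forall x z, h' x - h' z <= mdist x z) ->
  (detour_distance b h h' < +oo)%E -> exists c, forall x, `|h x - h' x| <= c.
Proof.
move=> hb hb' lip lip'; rewrite /detour_distance.
have := fun x => detour_cost_ge b h (lip' x).
have := fun x => detour_cost_ge b h' (lip x).
case: (detour_cost b h' h) => [s||] sP; case: (detour_cost b h h') => [r||] rP //.
- move=> _; exists (Num.max s r) => x; rewrite ler_norml le_max.
  have := sP x; have := rP x; rewrite !lee_fin => rx sx.
  by rewrite sx orTb andbT lerNl opprB le_max rx orbT.
(* In the remaining cases some cost is [-oo], contradicting its real lower bound at [b]. *)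
- by have := rP b; rewrite leNgt ltNyr.
- by have := rP b; rewrite leNgt ltNyr.
- by have := sP b; rewrite leNgt ltNyr.
- by have := sP b; rewrite leNgt ltNyr.
- by have := sP b; rewrite leNgt ltNyr.
Qed.

(** Turns an infinite detour distance between distinct Busemann points of a factor into an unbounded
    difference. *)
Lemma bounded_detour_distance_lty b h h' (y y' : nat -> M) (t t' : nat -> R) (c : R) :
  ray_limit h y t -> ray_limit h' y' t' -> h b = 0 -> h' b = 0 ->
  (forall x, `|h x - h' x| <= c) -> (detour_distance b h h' < +oo)%E.
Proof.
move=> hr hr' hb hb' hc.
apply: (@le_lt_trans _ _ (c%:E + c%:E)%E); last by rewrite -EFinD ltry.
apply: leeD; [apply: detour_cost_le hr hb _|apply: detour_cost_le hr' hb' _] => x.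
  by have := hc x; rewrite ler_norml; lra.
by have := hc x; rewrite ler_norml; lra.
Qed.

(* The point is found on a geodesic from [y n] to [y m] for a much larger [m]. *)
Lemma ray_limit_point h (y : nat -> M) (t : nat -> R) (n : nat) (s e : R) :
  geodesic_space M -> ray_limit h y t -> 0 < e -> t n <= s ->
  exists w, h w <= h (y n) + t n - s + e /\ mdist (y n) w <= s - t n.
Proof.
move=> Mg ry e0 ts; have [too hy h0] := ry.
have e20 : 0 < e / 2 by lra.
(* The third bound makes the geodesic from [y n] to [y m] at least [s - t n] long. *)
have : \forall m \near \oo, [/\ mdist (y n) (y m) - t m <= h (y n) + e / 2,
    h (y m) + t m <= e / 2 & s - t n - h (y n) + e / 2 <= t m].
  near=> m; split; near: m.
  - by apply: (cvgr_le _ (hy (y n))); lra.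
  - exact: (cvgr_le _ h0).
  - by move/cvgryPge : too.
move=> /filter_ex[m [H1 H2 H3]].
have H4 : h (y n) + t m - e / 2 <= mdist (y n) (y m).
  by have := ray_limit_lipschitz (y n) (y m) ry; lra.
have [|w [w1 w2]] := @geodesic_point _ _ (y n) (y m) (s - t n) Mg.
  by apply/andP; split; lra.
exists w; split; last by rewrite w1.
by have := ray_limit_lipschitz w (y m) ry; lra.
Unshelve. all: by end_near. Qed.

End Detour.

(** * Maxima of functions on the factors *)

Section Limits.
Context {R : realType} {M : metricType R}.
Implicit Types (x z b : M) (h : {ptws M -> R}).

(** The inequality [h x - h (y n) <= mdist x (y n)] supplies the missing halves of both limits, so
    upper bounds suffice. *)
Lemma lipschitz_ray_limit b h (y : nat -> M) (t : nat -> R) :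
  (forall x z, h x - h z <= mdist x z) -> t n @[n --> \oo] --> +oo ->
  (forall x e, 0 < e -> \forall n \near \oo, mdist x (y n) - t n <= h x + e) ->
  (forall e, 0 < e -> \forall n \near \oo, h (y n) + t n <= e) ->
  ray_limit h y t.
Proof.
move=> lip too hx hy; split => // [x|]; apply/cvgrPdist_le => e e0.
  apply: filterS2 (hx x e e0) (hy e e0) => n H1 H2.
  by have := lip x (y n); rewrite ler_norml; lra.
apply: filterS2 (hx b e e0) (hy e e0) => n H1 H2.
by have := lip b (y n); rewrite ler_norml; lra.
Qed.

(** Pull the neighbourhoods of [h] back to [M] and refine. With an ultrafilter, all bounded real
    quantities attached to [y] converge at once, without passing to subsequences. *)
Lemma metric_compactification_ultra b h : metric_compactification b h ->
  exists2 U : set_system M, UltraFilter U &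
    forall x, mdist x y - mdist b y @[y --> U] --> h x.
Proof.
move=> hb; pose F := filter_from (nbhs h) (fun V => internal_functional b @^-1` V).
have FF : ProperFilter F.
  apply: filter_from_proper.
    apply: filter_from_filter; first by exists setT; exact: filterT.
    by move=> V W Vh Wh; exists (V `&` W) => //; exact: filterI.
  by move=> V /hb[_ [[y _ <-] Vy]]; exists y.
have [U [UU FU]] := ultraFilterLemma FF; exists U => //.
have : {ptws, internal_functional b y @[y --> U] --> h}.
  by move=> V Vh; apply: FU; exists V.
by move=> /pointwise_cvgP.
Qed.

End Limits.

Section SupProduct.
Context {R : realType} {q : nat} {N : 'I_q -> metricType R}.
Implicit Types (J : {set 'I_q}) (x z b : sup_prod N) (g : forall j, {ptws N j -> R}).

Lemma mdist_coord_le x z j : mdist (x j) (z j) <= mdist x z.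
Proof. exact: (le_bigmax _ (fun j => mdist (x j) (z j))). Qed.

Lemma mdist_sup_le x z (c : R) : 0 <= c ->
  (forall j, mdist (x j) (z j) <= c) -> mdist x z <= c.
Proof. by move=> c0 xz; apply: bigmax_le. Qed.

(** Indexing [a] by [J] makes it literally a vector of [R^J], while [g] is a total family so that
    terms for different [J] can be compared. *)
Definition max_family J g (a : {ffun {j | j \in J} -> R}) : {ptws sup_prod N -> R} :=
  fun x => max_coord [ffun i => g (val i) (x (val i)) + a i].

Section MaxFamily.
Variables (J : {set 'I_q}) (g : forall j, {ptws N j -> R}) (i0 : {j | j \in J}).
Arguments g : clear implicits.
Implicit Type a : {ffun {j | j \in J} -> R}.

Lemma max_family_ge a x (i : {j | j \in J}) :
  g (val i) (x (val i)) + a i <= max_family g a x.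
Proof.
have := max_coord_ge [ffun i : {j | j \in J} => g (val i) (x (val i)) + a i] i.
by rewrite ffunE.
Qed.

Lemma max_family_attained a x :
  exists i : {j | j \in J}, max_family g a x = g (val i) (x (val i)) + a i.
Proof.
have [i] := max_coord_attained [ffun i : {j | j \in J} => g (val i) (x (val i)) + a i] i0.
by rewrite ffunE => gE; exists i.
Qed.

(** This is the origin of the quotient by [Sp1]: normalising at [b] picks one vector in each
    class. *)
Lemma max_family_shift a (c : R) x :
  max_family g (a + [ffun=> c]) x = max_family g a x + c.
Proof.
apply/eqP; rewrite eq_le; apply/andP; split.
  have [i ->] := max_family_attained (a + [ffun=> c]) x.
  by rewrite !ffunE addrA lerD2r max_family_ge.
have [i ->] := max_family_attained a x.
by have := max_family_ge (a + [ffun=> c]) x i; rewrite !ffunE addrA.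
Qed.

Lemma max_family_lipschitz a x z :
  (forall i : {j | j \in J}, forall u v, g (val i) u - g (val i) v <= mdist u v) ->
  max_family g a x - max_family g a z <= mdist x z.
Proof.
move=> lip; have [i ->] := max_family_attained a x.
have := max_family_ge a z i; have := lip i (x (val i)) (z (val i)).
have := mdist_coord_le x z (val i); lra.
Qed.

(* At stage [n] the [j]-th coordinate is placed near the ray of [g j], at
   parameter [t n + a j], and at [b j] if [j \notin J]. *)
Lemma max_family_ray a b :
  (forall j, geodesic_space (N j)) ->
  (forall j, j \in J -> exists (y : nat -> N j) (t : nat -> R), ray_limit (g j) y t) ->
  exists (y : nat -> sup_prod N) (t : nat -> R), ray_limit (max_family g a) y t.
Proof.
move=> Ngeo gray.
have lip (i : {j | j \in J}) u v : g (val i) u - g (val i) v <= mdist u v.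
  by have [y [t yt]] := gray _ (valP i); exact: ray_limit_lipschitz yt.
have rayE j : exists ut : (nat -> N j) * (nat -> R), j \in J -> ray_limit (g j) ut.1 ut.2.
  have [/gray[u [t ut]]|_] := boolP (j \in J); first by exists (u, t).
  by exists (fun=> b j, fun=> 0).
pose u j := (projT1 (cid (rayE j))).1; pose T j := (projT1 (cid (rayE j))).2.
have uT j : j \in J -> ray_limit (g j) (u j) (T j) := projT2 (cid (rayE j)).
(* Extends [a] by 0 outside [J]. *)
pose c j := oapp a 0 (insub j).
have cE i : c (val i) = a i by rewrite /c valK.
(* Large enough to tend to infinity and to satisfy [T j n <= t n + c j] for every [j], as
   [ray_limit_point] requires. *)
pose t (n : nat) : R := n%:R + \big[Num.max/0]_j (T j n - c j).
have tT n j : T j n <= t n + c j.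
  have := le_bigmax 0 (fun j => T j n - c j) j.
  by have := ler0n R n; rewrite /t; lra.
have tn n : n%:R <= t n by rewrite /t lerDl bigmax_ge_id.
have pointE n j : exists w : N j,
    if j \in J then
      g j w <= g j (u j n) + T j n - (t n + c j) + n.+1%:R^-1 /\
      mdist (u j n) w <= t n + c j - T j n
    else w = b j.
  case: (boolP (j \in J)) => [jJ|_]; last by exists (b j).
  by apply: (ray_limit_point (Ngeo j) (uT j jJ)) => //; rewrite invr_gt0.
have [y yP] : exists y : nat -> sup_prod N, forall n j, if j \in J then
      g j (y n j) <= g j (u j n) + T j n - (t n + c j) + n.+1%:R^-1 /\
      mdist (u j n) (y n j) <= t n + c j - T j n
    else y n j = b j.
  by exists (fun n j => projT1 (cid (pointE n j))) => n j;
    exact: projT2 (cid (pointE n j)).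
have too : t n @[n --> \oo] --> +oo.
  by apply/cvgryPge => k; near=> n; apply: le_trans (tn n);
  near: n; exact: nbhs_infty_ger.
exists y, t; apply: (lipschitz_ray_limit b) => //.
- by move=> x z; exact: max_family_lipschitz.
- move=> x e e0.
  have near_coord : \forall n \near \oo, forall j : 'I_q,
      mdist (x j) (y n j) <= t n + max_family g a x + e.
    apply: filter_forall => j; have [jJ|jJ] := boolP (j \in J).
      have [_ /(_ (x j)) ux _] := uT j jJ.
      have : \forall n \near \oo, mdist (x j) (u j n) - T j n <= g j (x j) + e.
        by apply: (cvgr_le _ ux); lra.
      apply: filterS => n; have := yP n j; rewrite jJ => -[_ wn].
      have := max_family_ge a x (exist _ j jJ); rewrite -cE /=.
      by have := mdist_triangle (x j) (u j n) (y n j); lra.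
    (* Outside [J] the coordinate stays at [b j], at a fixed distance from [x j], while [t n]
       grows. *)
    have : \forall n \near \oo, mdist (x j) (b j) - max_family g a x - e <= t n.
      by move/cvgryPge : too.
    by apply: filterS => n; have := yP n j; rewrite (negbTE jJ) => ->; lra.
  have pos : \forall n \near \oo, - max_family g a x - e <= t n.
    by move/cvgryPge : too.
  apply: filterS2 near_coord pos => n xy tpos; rewrite lerBlDr.
  by apply: mdist_sup_le => [|j]; [lra|have := xy j; lra].
- move=> e e0.
  have : \forall n \near \oo, forall j : 'I_q, j \in J ->
      g j (u j n) + T j n + n.+1%:R^-1 <= e.
    apply: filter_forall => j; have [jJ|_] := boolP (j \in J); last exact: nearW.
    have [_ _ u0] := uT j jJ; have e20 : 0 < e / 2 by lra.
    apply: filterS2 (cvgr_le _ u0 _ e20) (near_infty_natSinv_lt (PosNum e20)) => n /=.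
    by set r := n.+1%:R^-1; lra.
  apply: filterS => n un; have [i ->] := max_family_attained a (y n).
  have := yP n (val i); rewrite (valP i) => -[gw _].
  by have := un _ (valP i); rewrite -cE; move: gw; set r := n.+1%:R^-1; lra.
Unshelve. all: by end_near. Qed.

End MaxFamily.

Lemma far_point J g x j0 (k : R) :
  (forall j, j \in J -> forall k, exists w, g j w <= - k) ->
  exists z : sup_prod N, z j0 = x j0 /\
    forall j, j \in J -> j != j0 -> g j (z j) <= - k.
Proof.
move=> gN.
have H j : exists w : N j, (j == j0 -> w = x j) /\ (j \in J -> j != j0 -> g j w <= - k).
  have [->|jj0] := eqVneq j j0; first by exists (x j0).
  by have [/gN/(_ k)[w wk]|//] := boolP (j \in J); [exists w|exists (x j)].
exists (fun j => projT1 (cid (H j))); split=> [|j].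
  by have [+ _] := projT2 (cid (H j0)); apply.
by have [_] := projT2 (cid (H j)).
Qed.

(* Moving the coordinates other than [i] far along their rays leaves only the
   [i]-th term in the maximum. *)
Lemma max_family_le_term J J' g g' (a : {ffun {j | j \in J} -> R})
    (a' : {ffun {j | j \in J'} -> R}) (c : R) (i' : {j | j \in J'}) :
  (forall j, j \in J' -> forall k, exists w, g' j w <= - k) ->
  (forall x, max_family g a x <= max_family g' a' x + c) ->
  forall (i : {j | j \in J}) x, exists2 k : {j | j \in J'}, val k = val i &
    g (val i) (x (val i)) + a i <= g' (val i) (x (val i)) + a' k + c.
Proof.
move=> gN lec i x.
pose K := max_coord a' + c - (g (val i) (x (val i)) + a i) + 1.
have [z [zi zN]] := far_point x (val i) K gN.
have := lec z; have [k ->] := max_family_attained g' i' a' z.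
have := max_family_ge g a z i; rewrite zi.
have [ki|ki] := eqVneq (val k) (val i); last first.
  by have := zN _ (valP k) ki; have := max_coord_ge a' k; rewrite /K; lra.
move=> Hi Hk; exists k => //; move: Hk; rewrite ki zi; lra.
Qed.

End SupProduct.

(** * Horofunctions of the product and their parts *)

Section Decomposition.
Context {R : realType} {q : nat} {N : 'I_q -> metricType R}.
Implicit Types (b : sup_prod N) (h : {ptws sup_prod N -> R}).

(** Otherwise the ultrafilter contains a ball; by properness each coordinate converges, and the
    limit point [p] makes [h] internal. *)
Lemma horofunction_escapes b h (U : set_system (sup_prod N)) :
  (forall j, proper_space (N j)) -> UltraFilter U ->
  (forall x, mdist x y - mdist b y @[y --> U] --> h x) ->
  ~ range (internal_functional b) h -> mdist b y @[y --> U] --> +oo.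
Proof.
move=> Nproper UU hU hNint; apply/cvgryPge => k.
have [//|bk] := in_ultra_setVsetC [set y | k <= mdist b y] UU.
exfalso; apply: hNint.
have coord j : exists p : N j,
    forall e : R, 0 < e -> \forall y \near U, mdist p (y j) <= e.
  apply: (@ultra_proper_cvg _ _ _ UU (N j) (fun y => y j) (b j) k (Nproper j)).
  apply: filterS bk => y /= /negP; rewrite -ltNge => /ltW; apply: le_trans.
  exact: mdist_coord_le.
pose p : sup_prod N := fun j => projT1 (cid (coord j)).
have pU (e : R) : 0 < e -> \forall y \near U, mdist p y <= e.
  move=> e0; have : \forall y \near U, forall j, mdist (p j) (y j) <= e.
    by apply: filter_forall => j; exact: (projT2 (cid (coord j)) e e0).
  by apply: filterS => y py; apply: mdist_sup_le => //; exact: ltW.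
exists p => //; apply/funext => x; apply: (cvg_unique _ _ (hU x)) => //.
apply/cvgrPdist_le => e e0; have e20 : 0 < e / 2 by lra.
apply: filterS (pU _ e20) => y py; rewrite /internal_functional ler_norml.
have := mdist_triangle x p y; have := mdist_triangle x y p.
have := mdist_triangle b p y; have := mdist_triangle b y p.
by rewrite (mdistC y p); lra.
Qed.

Lemma horofunction_max_family (bN : forall j, N j) b h :
  (forall j, proper_space (N j)) -> (forall j, geodesic_space (N j)) ->
  horofunction b h ->
  exists (J : {set 'I_q}) (g : forall j, {ptws N j -> R}) (a : {ffun {j | j \in J} -> R}),
    [/\ J != finset.set0, forall j, j \in J -> horofunction (bN j) (g j),
        h b = 0 & h = max_family g a].
Proof.
move=> Nproper Ngeo [/metric_compactification_ultra[U UU hU] hNint].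
have boo := horofunction_escapes Nproper UU hU hNint.
have hb : h b = 0.
  have := hU b; under eq_cvg do rewrite subrr.
  by move=> /(cvg_unique _ (cvg_cst 0)) <-.
(* Bounded above for every [j]. The set [J] collects the [j] for which it is also bounded below
   along [U]; for the others it tends to [-oo]. The change from [b j] to [bN j] is absorbed in the
   limits [a]. *)
pose m j (y : sup_prod N) : R := mdist (bN j) (y j) - mdist b y.
have m_le j y : m j y <= mdist (bN j) (b j).
  have := mdist_triangle (bN j) (b j) (y j).
  by have := mdist_coord_le b y j; rewrite /m; lra.
pose J : {set 'I_q} := [set j | `[< exists k, \forall y \near U, k <= m j y >]]%SET.
have JP j : j \in J -> exists k, \forall y \near U, k <= m j y.
  by rewrite inE => /asboolP.
have JN j k : j \notin J -> \forall y \near U, m j y <= k.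
  rewrite inE => /asboolPn jJ.
  have [kU|] := in_ultra_setVsetC [set y | k <= m j y] UU; first by case: jJ; exists k.
  by apply: filterS => y /= /negP; rewrite -ltNge => /ltW.
have gE j : exists gj : {ptws N j -> R},
    forall x, mdist x (y j) - mdist (bN j) (y j) @[y --> U] --> gj x.
  suff /choice[gj gjP] : forall x, exists l : R,
      mdist x (y j) - mdist (bN j) (y j) @[y --> U] --> l by exists gj.
  move=> x; apply: (ultra_bounded_cvg UU (k := mdist x (bN j))); apply: nearW => y.
  have := ler_mdist_sub x (bN j) (y j); have := ler_mdist_sub (bN j) x (y j).
  by rewrite (mdistC (bN j) x) ler_norml; lra.
pose g j : {ptws N j -> R} := projT1 (cid (gE j)).
have gU j x : mdist x (y j) - mdist (bN j) (y j) @[y --> U] --> g j x.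
  exact: (projT2 (cid (gE j)) x).
have aE (i : {j | j \in J}) : exists l : R, m (val i) y @[y --> U] --> l.
  have [k km] := JP _ (valP i).
  apply: (ultra_bounded_cvg UU (k := Num.max (- k) (mdist (bN (val i)) (b (val i))))).
  apply: filterS km => y ky; rewrite ler_norml lerNl le_max lerN2 ky /=.
  by rewrite le_max m_le orbT.
have /choice[a' a'U] := aE; pose a : {ffun {j | j \in J} -> R} := [ffun i => a' i].
have gaU (i : {j | j \in J}) (x : sup_prod N) :
    (fun y : sup_prod N => mdist (x (val i)) (y (val i)) - mdist b y) @ U -->
    g (val i) (x (val i)) + a i.
  rewrite ffunE; apply: cvg_trans (cvgD (gU _ _) (a'U i)).
  by apply: near_eq_cvg; apply: nearW => y; rewrite !fctE /m; lra.
(* If [J] were empty, all coordinate distances from [b] to [y] would eventually be at most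
   [mdist b y - 1], and so would their maximum. *)
have J0 : J != finset.set0.
  apply/negP => /eqP J0.
  have mU : \forall y \near U, forall j, m j y <= - mdist (bN j) (b j) - 1.
    by apply: filter_forall => j; apply: JN; rewrite J0 inE.
  have b1 : \forall y \near U, 1 <= mdist b y by move/cvgryPge : boo.
  have [y [my y1]] := filter_ex (filterI mU b1).
  suff : mdist b y <= mdist b y - 1 by lra.
  apply: mdist_sup_le => [|j]; first by lra.
  have := mdist_triangle (b j) (bN j) (y j); have := my j.
  by rewrite (mdistC (b j) (bN j)) /m; lra.
have /finset.set0Pn[j0 j0J] := J0.
exists J, g, a; split => //.
  move=> j jJ; split; first exact: cvg_metric_compactification (gU j).
  apply: unbounded_not_internal.
  apply: (escaping_limit_unbounded UU (Nproper j) (Ngeo j) (gU j)).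
  have [k km] := JP j jJ; apply/cvgryPge => l.
  have bl : \forall y \near U, l - k <= mdist b y by move/cvgryPge : boo.
  by apply: filterS2 km bl => y; rewrite /m; lra.
apply/funext => x; apply/eqP; rewrite eq_le; apply/andP; split; last first.
  have [i ->] := max_family_attained g (exist _ j0 j0J) a x.
  apply: (ler_cvg_to (gaU i x) (hU x)); apply: nearW => y.
  by have := mdist_coord_le x y (val i); lra.
apply/ler_addgt0Pr => e e0; apply: (cvgr_to_le (hU x)).
(* For [j] in [J] this is the limit [gaU]; for the others [m j y] eventually lies below any
   bound. *)
have xU : \forall y \near U, forall j,
    mdist (x j) (y j) <= mdist b y + max_family g a x + e.
  apply: filter_forall => j; have [jJ|jJ] := boolP (j \in J).
    have := gaU (exist _ j jJ) x => /= gax.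
    have gle := max_family_ge g a x (exist _ j jJ).
    have : \forall y \near U, mdist (x j) (y j) - mdist b y <= max_family g a x + e.
      by apply: (cvgr_le _ gax); move: gle => /=; lra.
    by apply: filterS => y; lra.
  apply: filterS (JN j (max_family g a x + e - mdist (x j) (bN j)) jJ) => y.
  by have := mdist_triangle (x j) (bN j) (y j); rewrite /m; lra.
have pos : \forall y \near U, - max_family g a x - e <= mdist b y.
  by move/cvgryPge : boo.
apply: filterS2 xU pos => y xy ypos; rewrite lerBlDr.
by apply: mdist_sup_le => [|j]; [lra|have := xy j; lra].
Qed.

End Decomposition.

(** * Detour distance and parts in terms of the vectors [a] *)

Section Part.
Context {R : realType} {q : nat} {N : 'I_q -> metricType R}.
Implicit Types (b : sup_prod N) (h : {ptws sup_prod N -> R}).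

Section Rays.
Variables (J : {set 'I_q}) (g : forall j, {ptws N j -> R}) (i0 : {j | j \in J}).
Arguments g : clear implicits.
Hypothesis Ngeo : forall j, geodesic_space (N j).
Hypothesis gray : forall j, j \in J ->
  exists (y : nat -> N j) (t : nat -> R), ray_limit (g j) y t.
Implicit Type a : {ffun {j | j \in J} -> R}.

(** Term-by-term comparison at equal indices, where the common values of [g] cancel. *)
Lemma max_family_le_shift b a a' (c : R) :
  (forall x, max_family g a x <= max_family g a' x + c) -> forall i, a i <= a' i + c.
Proof.
move=> ac i; have [|k /val_inj -> ] := max_family_le_term i0 _ ac i b; last lra.
by move=> j /gray[y [t ty]]; exact: ray_limit_unbounded ty.
Qed.

Lemma max_family_inj b : injective (max_family (N := N) (J := J) g).
Proof.
move=> a a' aa'; apply/ffunP => i; apply/eqP; rewrite eq_le.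
have [] : a i <= a' i + 0 /\ a' i <= a i + 0; last by rewrite !addr0 => -> ->.
by split; apply: (max_family_le_shift b) => x; rewrite aa' addr0.
Qed.

Lemma detour_cost_max_family b a a' :
  max_family g a b = 0 -> max_family g a' b = 0 ->
  detour_cost b (max_family g a) (max_family g a') = (max_coord (a' - a))%:E.
Proof.
move=> ab a'b.
have [y [t ty]] := max_family_ray i0 a b Ngeo gray.
have [y' [t' ty']] := max_family_ray i0 a' b Ngeo gray.
have le : (detour_cost b (max_family g a) (max_family g a') <= (max_coord (a' - a))%:E)%E.
  apply: (detour_cost_le ty ab) => x.
  have [i ->] := max_family_attained g i0 a' x.
  have := max_family_ge g a x i; have := max_coord_ge (a' - a) i.
  by rewrite !ffunE; lra.
apply/eqP; rewrite eq_le le /=; move: le.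
(* A real value [r] of the cost bounds all differences of the two functions, so
   [max_family_le_shift] bounds the coordinates of [a' - a] by [r]. *)
have := fun x => detour_cost_ge b (max_family g a) (fun z => ray_limit_lipschitz x z ty').
case: (detour_cost _ _ _) => [r rP _||]; last 2 first.
- by rewrite leey.
- by move=> /(_ b); rewrite leNgt ltNyr.
have [i ->] := max_coord_attained (a' - a) i0; rewrite lee_fin !ffunE lerBlDl.
by apply: (max_family_le_shift b) => x; have := rP x; rewrite lee_fin lerBlDl.
Qed.

Lemma detour_distance_max_family b a a' :
  max_family g a b = 0 -> max_family g a' b = 0 ->
  detour_distance b (max_family g a) (max_family g a') =
    (var_norm
      (\pi_{quot (Sp1 R {j | j \in J})} a - \pi_{quot (Sp1 R {j | j \in J})} a'))%:E.
Proof.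
move=> ab a'b; rewrite /detour_distance !detour_cost_max_family//.
by rewrite -pi_is_zmod_morphism var_norm_pi// opprB addrC.
Qed.

(** The isometry sends a point of the part to the class of its vector of constants. *)
Lemma part_isometric_max_family b a :
  max_family g a b = 0 ->
  (forall h, part b (max_family g a) h -> exists a', h = max_family g a') ->
  part_isometric_var b (max_family g a) J.
Proof.
move=> ab partE; set h0 := max_family g a in partE *.
have /choice[A AP] : forall h, exists a', part b h0 h -> h = max_family g a'.
  move=> h; have [/partE[a' ->]|] := pselect (part b h0 h); first by exists a'.
  by exists a.
have A0 h : part b h0 h -> max_family g (A h) b = 0.
  by move=> ph; rewrite -(AP h ph); have [/busemann_ray[]] := ph.
exists (fun h => \pi_{quot (Sp1 R {j | j \in J})} (A h)); split; last first.
  by move=> h1 h2 p1 p2; rewrite {1}(AP _ p1) {1}(AP _ p2) detour_distance_max_family ?A0.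
split=> // [h1 h2 /set_mem p1 /set_mem p2 /eqP|v _].
  (* Injectivity: two vectors in one class differ by a constant [l], and both functions vanish at
     [b], so [l = 0]. *)
  rewrite -idealrBE => /asboolP[l /eqP]; rewrite subr_eq addrC => /eqP Al.
  rewrite (AP _ p1) (AP _ p2); apply/funext => x.
  have := A0 _ p1; rewrite Al max_family_shift// (A0 _ p2) add0r => l0.
  by rewrite max_family_shift// l0 addr0.
(* Surjectivity: shift a representative so that its function vanishes at [b]. *)
pose a0 := repr v; pose a1 := a0 + [ffun=> - max_family g a0 b].
have a1b : max_family g a1 b = 0 by rewrite max_family_shift// subrr.
have p1 : part b h0 (max_family g a1).
  have [y [t ty]] := max_family_ray i0 a1 b Ngeo gray.
  by split; [exact: ray_busemann ty|rewrite detour_distance_max_family// ltry].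
exists (max_family g a1) => //=; rewrite -(max_family_inj b (AP _ p1)) -[RHS]reprK.
apply/eqP; rewrite -idealrBE addrC addKr; apply/asboolP; eexists; reflexivity.
Qed.

End Rays.

(* Finite detour distance means bounded difference, which first forces the index
   sets to coincide and then, factor by factor, the functions themselves. *)
Lemma bounded_max_family_eq (bN : forall j, N j) (J J' : {set 'I_q}) g g'
    (a : {ffun {j | j \in J} -> R}) (a' : {ffun {j | j \in J'} -> R}) b (c : R) :
  (forall j (hj hj' : {ptws N j -> R}), busemann (bN j) hj -> busemann (bN j) hj' ->
    hj <> hj' -> detour_distance (bN j) hj hj' = +oo%E) ->
  J != finset.set0 -> J' != finset.set0 ->
  (forall j, j \in J -> busemann (bN j) (g j)) ->
  (forall j, j \in J' -> busemann (bN j) (g' j)) ->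
  (forall x, `|max_family g a x - max_family g' a' x| <= c) ->
  exists a'' : {ffun {j | j \in J} -> R}, max_family g' a' = max_family g a''.
Proof.
move=> Ndetour /finset.set0Pn[j0 jJ0] /finset.set0Pn[j1 jJ1] gB g'B hc.
have gN j : j \in J -> forall k, exists w, g j w <= - k.
  by move=> /gB/busemann_ray[_ [y [t ty]]]; exact: ray_limit_unbounded ty.
have g'N j : j \in J' -> forall k, exists w, g' j w <= - k.
  by move=> /g'B/busemann_ray[_ [y [t ty]]]; exact: ray_limit_unbounded ty.
have le x : max_family g a x <= max_family g' a' x + c.
  by have := hc x; rewrite ler_norml; lra.
have ge x : max_family g' a' x <= max_family g a x + c.
  by have := hc x; rewrite ler_norml; lra.
have leP := max_family_le_term (exist _ j1 jJ1) g'N le.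
have geP := max_family_le_term (exist _ j0 jJ0) gN ge.
have JJ' : J = J'.
  apply/setP => j; apply/idP/idP => jJ.
    by have [k /= kj _] := leP (exist _ j jJ) b; rewrite -kj; exact: valP.
  by have [k /= kj _] := geP (exist _ j jJ) b; rewrite -kj; exact: valP.
move: JJ' => JJ'; subst J'; exists a'.
suff gg' j : j \in J -> g j = g' j.
  apply/funext => x; congr max_coord.
  by apply/ffunP => i; rewrite !ffunE gg' //; exact: valP.
move=> jJ; have [gb [y [t ty]]] := busemann_ray (gB j jJ).
have [g'b [y' [t' ty']]] := busemann_ray (g'B j jJ).
apply: contrapT => /(Ndetour j _ _ (gB j jJ) (g'B j jJ)).
pose i : {j | j \in J} := exist _ j jJ.
suff /(bounded_detour_distance_lty ty ty' gb g'b) : forall u,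
    `|g j u - g' j u| <= c + `|a i| + `|a' i| by move=> + E; rewrite E ltxx.
(* The point [b] with its [j]-th coordinate replaced by [u]: comparing [i]-th terms both ways gives
   a bound independent of [u]. *)
move=> u; pose x : sup_prod N := dfwith b j u.
have xj : x j = u by rewrite /x dfwithin.
have [k /val_inj -> le1] := leP i x; have [k' /val_inj -> ge1] := geP i x.
move: le1 ge1; rewrite /= xj => le1 ge1.
have := ler_norm (a i); have := ler_norm (- a i); have := ler_norm (a' i).
have := ler_norm (- a' i); rewrite !normrN ler_norml; lra.
Qed.

End Part.

Theorem theorem2p8 (R : realType) (q : nat) (N : 'I_q -> metricType R)
    (bN : forall j : 'I_q, N j) (b : sup_prod N)
    (Nproper : forall j : 'I_q, proper_space (N j))
    (Ngeodesic : forall j : 'I_q, geodesic_space (N j))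
    (Nbusemann : forall (j : 'I_q) (hj : {ptws N j -> R}),
      horofunction (bN j) hj -> busemann (bN j) hj)
    (Ndetour : forall (j : 'I_q) (hj hj' : {ptws N j -> R}),
      busemann (bN j) hj -> busemann (bN j) hj' -> hj <> hj' ->
      detour_distance (bN j) hj hj' = +oo%E) :
  forall h : {ptws sup_prod N -> R}, horofunction b h ->
    busemann b h /\
    exists J : {set 'I_q}, J != finset.set0 /\ part_isometric_var b h J.
Proof.
move=> h hh.
have [J [g [a [J0 gh hb hE]]]] := horofunction_max_family bN Nproper Ngeodesic hh.
have gB j (jJ : j \in J) := Nbusemann j _ (gh j jJ).
have gray j : j \in J -> exists (y : nat -> N j) (t : nat -> R), ray_limit (g j) y t.
  by move=> /gB/busemann_ray[].
have /finset.set0Pn[j0 j0J] := J0.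
have [y [t ty]] := max_family_ray (exist _ j0 j0J) a b Ngeodesic gray.
rewrite hE in hb *; split; first exact: ray_busemann ty.
exists J; split=> //.
apply: (part_isometric_max_family (exist _ j0 j0J)) => // h' [h'B h'D].
have [[h'H _] [h'b [y' [t' ty']]]] := (h'B, busemann_ray h'B).
(* A point of the part has its own decomposition; the finite detour distance to [h] then lets it be
   rewritten with [J] and [g]. *)
have [J' [g' [a' [J'0 g'h _ h'E]]]] := horofunction_max_family bN Nproper Ngeodesic h'H.
have [c hc] := detour_distance_lty_bounded hb h'b
  (fun x z => ray_limit_lipschitz x z ty) (fun x z => ray_limit_lipschitz x z ty') h'D.
rewrite h'E in hc *; apply: (bounded_max_family_eq b Ndetour J0 J'0 gB _ hc).
by move=> j /g'h/Nbusemann.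
Qed.
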